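(* Let $D$ be an integral domain, and let $R$ be a retract $D$-algebra. Then: (a) $R$ is an extension of $D$ (i.e., the canonical $D$-algebra homomorphism $D\to R$ is injective). (b) If $S\subseteq R$ is a $D$-algebra (i.e., a $D$-subalgebra of $R$), then $S$ is a retract $D$-algebra. (c) If $K$ is the quotient field of $D$, then $R\cap K=D$ (intersection inside the quotient field of $R$). (d) The restriction map of spectra $\mathrm{Spec}(R)\to\mathrm{Spec}(D)$, $P\mapsto P\cap D$, is surjective. (e) If $R\neq D$, then $\dim(R)\geq\dim(D)+1$, where $\dim$ denotes Krull dimension.
   Context: All rings are commutative with unit; $D$ is an integral domain that is not a field. A retract $D$-algebra is a $D$-algebra $R$ that is an integral domain and for which there exists a $D$-algebra homomorphism $\epsilon:R\to D$ (called a retract of $R$ onto $D$). *)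

(* Defs.v *)
From HB Require Import structures.
From mathcomp Require Import all_boot all_order all_algebra.
From mathcomp Require Import boolp classical_sets functions constructive_ereal.

Set Implicit Arguments.
Unset Strict Implicit.
Unset Printing Implicit Defensive.
Import Order.TTheory GRing.Theory Num.Theory.
Local Open Scope classical_set_scope.
Local Open Scope ring_scope.

#[short(type="idomainAlgType")]
HB.structure Definition IdomainAlgebra (D : nzRingType) :=
  {R of GRing.IntegralDomain R & GRing.ComAlgebra D R}.

(* Stated on comAlgType, with the integral domain axiom explicit, so that it
   also applies to subalgebras, which have no canonical unitRingType
   structure.  A morphism of D-algebras R -> D^o maps d%:A to d. *)
Definition retract_algebra (D : idomainType) (R : comAlgType D) : Prop :=
  GRing.integral_domain_axiom R /\ inhabited {lrmorphism R -> D^o}.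

Section Subalgebra.
Variables (D : idomainType) (R : comAlgType D) (S : subalgClosed R).

Record subalg := Subalg { subalg_val : R; _ : subalg_val \in S }.

HB.instance Definition _ := [isSub for subalg_val].
HB.instance Definition _ := [Choice of subalg by <:].
HB.instance Definition _ :=
  GRing.SubChoice_isSubAlgebra.Build D R _ subalg (GRing.subsemialgClosedP S).
HB.instance Definition _ := GRing.SubNzRing_isSubComNzRing.Build R _ subalg.

End Subalgebra.

Section FracMap.
Variables (D R : idomainType).

(* The map induced by f on quotient fields; it is meaningful when f is an
   injective ring morphism, see frac_mapE. *)
Definition frac_map (f : D -> R) (z : {fraction D}) : {fraction R} :=
  FracField.tofrac (f (frac (repr z)).1) /
  FracField.tofrac (f (frac (repr z)).2).

Lemma fracE (z : {fraction D}) :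
  z = FracField.tofrac (frac (repr z)).1 / FracField.tofrac (frac (repr z)).2.
Proof.
rewrite -[LHS]reprK; case: (repr z) => -[n d] /= d0.
rewrite /GRing.inv /= /GRing.mul /=; unlock FracField.tofrac.
rewrite -[X in FracField.mul _ X]FracField.pi_inv -[RHS]FracField.pi_mul.
apply/eqmodP; rewrite /= FracField.equivfE /FracField.mulf /FracField.invf.
by rewrite !numden_Ratio ?oner_neq0 ?mul1r ?mulr1 // mulrC.
Qed.

Lemma frac_mapE (f : {rmorphism D -> R}) (a b : D) :
  injective f -> b != 0 ->
  frac_map f (FracField.tofrac a / FracField.tofrac b) =
  FracField.tofrac (f a) / FracField.tofrac (f b).
Proof.
move=> finj b0; set z := _ / _ : {fraction D}.
have f0 x : (FracField.tofrac (f x) == 0) = (x == 0).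
  by rewrite tofrac_eq0 -(rmorph0 f) (inj_eq finj).
have d0 : (frac (repr z)).2 != 0 by exact: denom_ratioP.
have := fracE z; rewrite {1}/z /frac_map => /eqP.
move: (frac (repr z)).1 (frac (repr z)).2 d0 => n d d0.
rewrite eqr_div ?tofrac_eq0 // -!tofracM tofrac_eq => /eqP zE.
apply/eqP; rewrite eqr_div ?f0 // -!tofracM tofrac_eq -!rmorphM zE.
by [].
Qed.

End FracMap.

Definition Spec (R : comNzRingType) : set (set R) :=
  [set P | idealr_closed [in P] /\ prime_idealr_closed [in P]].
Arguments Spec : clear implicits.

(* P |-> P `&` D, where D acts on R through its image. *)
Definition contraction (D : idomainType) (R : comAlgType D)
  (P : set R) : set D := GRing.in_alg R @^-1` P.

Lemma contraction_Spec (D : idomainType) (R : comAlgType D) :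
  set_fun (Spec R) (Spec D) (@contraction D R).
Proof.
move=> P [[P0 P1 PI] Pp]; have cE d : (d \in contraction P) = (d%:A \in P).
  by [].
split; first split.
- by rewrite cE scale0r.
- by rewrite cE scale1r.
- move=> a u v; rewrite !cE => uP vP.
  by rewrite scalerDl -scalerA -[u%:A]mul1r scalerAl PI.
- by move=> u v; rewrite !cE -scalerA -[v%:A]mul1r scalerAl mul1r => /Pp.
Qed.

Section KrullDimension.
Variable R : comNzRingType.

(* n is the length of the chain P 0 `<` ... `<` P n *)
Definition prime_chain (n : nat) (P : nat -> set R) : Prop :=
  (forall i, (i <= n)%N -> Spec R (P i)) /\
  (forall i, (i < n)%N -> P i `<` P i.+1).

Definition chain_lengths : set nat := [set n | exists P, prime_chain n P].

Definition krull_dim : \bar int :=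
  supremum -oo%E [set n%:Z%:E | n in chain_lengths].

Lemma krull_dimP :
  supremums [set n%:Z%:E | n in chain_lengths] krull_dim.
Proof.
set E := [set n%:Z%:E | n in chain_lengths].
suff [x Ex] : supremums E !=set0.
  rewrite /krull_dim -/E /supremum; case: ifPn => [/eqP E0|_].
    by rewrite E0; split => [? []|y _]; rewrite ?leNye.
  by case: xgetP => [y _ //|/(_ x)].
have [[m mP]|unb] := pselect (exists m, ubound chain_lengths m); last first.
  exists +oo%E; split => [y _|]; first by rewrite leey.
  case=> [k|//|] kP.
  - case: unb; exists `|k|%N => n nE.
    have : (n%:Z%:E <= k%:E)%E by apply: kP; exists n.
    by rewrite lee_fin; case: k {kP} => // k; rewrite lez_nat.
  - case: unb; exists 0%N => n nE.
    by have : (n%:Z%:E <= -oo :> \bar int)%E by apply: kP; exists n.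
have [C0|[n0 n0E]] : chain_lengths = set0 \/ chain_lengths !=set0.
  by have [->|/set0P] := eqVneq chain_lengths set0; [left|right].
  by exists -oo%E; rewrite /E C0 image_set0; split => [? []|y _]; rewrite ?leNye.
have [s [sub slb]] : supremums chain_lengths !=set0.
  by apply: nat_supremums_neq0; exists m.
exists (s%:Z%:E : \bar int); split => [_ [n nE <-]|y yP].
  by rewrite lee_fin lez_nat; exact: sub.
have : (n0%:Z%:E <= y)%E by apply: yP; exists n0.
case: y yP => [k kP|_ _|//]; last by rewrite leey.
rewrite lee_fin; case: k kP => // k kP _; rewrite lee_fin lez_nat.
apply: slb => n nE; have : (n%:Z%:E <= k%:Z%:E)%E by apply: kP; exists n.
by rewrite lee_fin lez_nat.
Qed.

End KrullDimension.
Arguments krull_dim : clear implicits.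

(* Main.v *)
Require Import Defs.
From HB Require Import structures.
From mathcomp Require Import all_boot all_order all_algebra.
From mathcomp Require Import boolp classical_sets functions constructive_ereal.
Import Order.TTheory GRing.Theory Num.Theory.
Local Open Scope classical_set_scope.
Local Open Scope ring_scope.

(** For a retract [f : R -> D], the pullback [f @^-1` P] of a prime [P] of [D]
is a prime of [R] lying over [P]. If [r = a / b] with [a], [b] in [D], applying
[f] to [r * b = a] yields [r = f r]. An element [x] of [R] outside [D] gives the
nonzero element [x - f x] of the kernel of [f], so the zero ideal can be put
below the pullback of any chain of primes of [D]. *)

Lemma Spec_preimage {A B : comNzRingType} (f : {rmorphism A -> B}) (P : set B) :
  Spec B P -> Spec A (f @^-1` P).
Proof.
move=> [[P0 P1 PI] Pp]; have fE x : (x \in f @^-1` P) = (f x \in P) by [].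
split; first split.
- by rewrite fE rmorph0.
- by rewrite fE rmorph1.
- by move=> a u v; rewrite !fE rmorphD rmorphM; exact: PI.
- by move=> u v; rewrite !fE rmorphM => /Pp.
Qed.

Lemma Spec_zero_ideal (A : idomainType) : Spec A [set 0].
Proof.
have zE (x : A) : (x \in [set 0 : A]) = (x == 0).
  by apply/idP/eqP; rewrite inE.
split; first split.
- by rewrite zE.
- by rewrite zE oner_neq0.
- by move=> a u v; rewrite !zE => /eqP -> /eqP ->; rewrite mulr0 addr0.
- by move=> u v; rewrite !zE mulf_eq0.
Qed.

Lemma Spec_zero {A : comNzRingType} {P : set A} : Spec A P -> P 0.
Proof. by move=> [[/set_mem]]. Qed.

(** With [krull_dim_le], this reduces comparisons of dimensions to single chains, so finite and
    infinite dimension need no separate treatment. *)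
Lemma krull_dim_ub {A : comNzRingType} {n : nat} {P : nat -> set A} :
  prime_chain n P -> (n%:Z%:E <= krull_dim A)%E.
Proof. by move=> nP; apply: (krull_dimP A).1; exists n => //; exists P. Qed.

Lemma krull_dim_le (A : comNzRingType) (y : \bar int) :
  (forall n P, @prime_chain A n P -> (n%:Z%:E <= y)%E) -> (krull_dim A <= y)%E.
Proof. by move=> yub; apply: (krull_dimP A).2 => _ [n [P nP] <-]; exact: yub nP. Qed.

(** The retract restricts to [S], and integrality descends along the injection [val]. *)
Lemma retract_subalg {D : idomainType} {R : comAlgType D} (S : subalgClosed R) :
  retract_algebra R -> retract_algebra (subalg S).
Proof.
move=> [RI [f]]; split=> [x y xy0|].
  have := congr1 val xy0; rewrite rmorphM rmorph0 => /RI.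
  by rewrite -(rmorph0 (val : subalg S -> R)) !(inj_eq val_inj).
constructor; pose g : subalg S -> D^o := fun x => f (val x).
have g_linear : linear g by move=> a x y; rewrite /g !linearP.
have g_monoid : monoid_morphism g.
  by split=> [|x y]; rewrite /g ?rmorph1 ?rmorphM.
exact: (HB.pack_for {lrmorphism subalg S -> D^o} g
  (GRing.isLinear.Build D (subalg S) D^o *:%R g g_linear)
  (GRing.isMonoidMorphism.Build (subalg S) D^o g g_monoid)).
Qed.

Section Retract.
Context {D : idomainType} {R : idomainAlgType D} (f : {lrmorphism R -> D^o}).

Lemma retract_in_alg (d : D) : f d%:A = d.
(* Scaling in [D^o] is multiplication, so linearity leaves [d * 1]. *)
Proof. by rewrite linearZ rmorph1 /= [LHS]mulr1. Qed.

Lemma in_alg_inj_of_retract : injective (GRing.in_alg R).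
Proof. exact: can_inj retract_in_alg. Qed.

Lemma retract_frac :
  range (@FracField.tofrac R) `&` range (frac_map (GRing.in_alg R))
  = range (fun d : D => FracField.tofrac (GRing.in_alg R d)).
Proof.
have inj := in_alg_inj_of_retract; apply/seteqP; split=> [_ [[r _ <-] [z _]]|].
  have b0 : (frac (repr z)).2 != 0 by exact: denom_ratioP.
  rewrite (fracE z) (frac_mapE _ inj b0).
  move: (frac (repr z)).1 (frac (repr z)).2 b0 => a b b0 ab.
  have bA0 : GRing.in_alg R b != 0.
    by rewrite -(rmorph0 (GRing.in_alg R)) (inj_eq inj).
  (* Clearing the denominator gives an identity in [R] itself, as [tofrac] is injective; only there
     can [f] be applied. *)
  have rb : a%:A = r * b%:A.
    apply/eqP; rewrite -tofrac_eq tofracM -ab mulfVK //.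
    by rewrite tofrac_eq0.
  have aE : a = f r * b.
    rewrite -[LHS]retract_in_alg rb rmorphM; congr (_ * _).
    exact: retract_in_alg.
  (* Both [r] and [(f r)%:A] have product [a%:A] with the nonzero [b%:A], which cancels. *)
  exists (f r) => //; congr FracField.tofrac; apply: (mulIf bA0).
  by rewrite -rmorphM -[RHS]rb aE.
move=> _ [d _ <-]; split; first by exists d%:A.
exists (FracField.tofrac d / FracField.tofrac 1) => //.
by rewrite (frac_mapE _ inj) ?oner_neq0 // rmorph1 tofrac1 divr1.
Qed.

(** Pulling back along [f] and then along [GRing.in_alg R] is pulling back along their composite,
    the identity of [D]. *)
Lemma contraction_preimage (P : set D) : contraction (f @^-1` P) = P.
Proof. by apply/funext => d; rewrite /contraction /preimage /= retract_in_alg. Qed.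

Lemma retract_ker_neq0 :
  range (GRing.in_alg R) <> [set: R] -> exists2 x : R, f x = 0 & x != 0.
Proof.
move=> RD; have [x xD] : exists x, ~ range (GRing.in_alg R) x.
  by apply/not_existsP => allD; apply: RD; apply/seteqP; split=> // x _;
    apply: contrapT; exact: allD.
exists (x - (f x)%:A).
  by apply/eqP; rewrite rmorphB subr_eq0; apply/eqP/esym; exact: retract_in_alg.
(* If the difference vanished, [x] would be the image of [f x]. *)
by apply: contra_not_neq xD => /subr0_eq ->; exists (f x).
Qed.

Lemma retract_prime_chain {n : nat} {P : nat -> set D} :
  range (GRing.in_alg R) <> [set: R] -> prime_chain n P ->
  prime_chain n.+1 (fun i => if i is j.+1 then f @^-1` P j else [set 0 : R]).
Proof.
move=> /retract_ker_neq0 [x fx0 x0] [PS Plt]; split=> [[|i] ilen|[|i] ilen].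
- exact: Spec_zero_ideal.
- exact: Spec_preimage (PS _ ilen).
(* At the bottom, the kernel element [x] lies in the pullback of [P 0] because [0] is in [P 0],
   which makes the inclusion strict. *)
- have P00 := Spec_zero (PS 0%N (leq0n n)).
  split=> [_ ->|sub0]; first by rewrite /preimage /= rmorph0.
  by move/eqP: x0; apply; apply: sub0; rewrite /preimage /= fx0.
(* Higher up, strictness survives because [f] is onto: an inclusion of pullbacks, tested on the
   elements [d%:A], gives one in [D]. *)
- have [sub nsub] := Plt i ilen; split=> [y|sub']; first exact: sub.
  by apply: nsub => d; rewrite -[d in X in X -> _]retract_in_alg => /sub';
    rewrite /preimage /= retract_in_alg.
Qed.

Lemma retract_krull_dim :
  range (GRing.in_alg R) <> [set: R] -> (krull_dim D + 1 <= krull_dim R)%E.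
Proof.
(* As [1] is finite, it can be moved to the right even when a dimension is infinite; [krull_dim D]
   is then alone and can be bounded chain by chain. *)
move=> RD; rewrite -leeBrDr //; apply: krull_dim_le => n P nP.
rewrite leeBrDr // -EFinD -[n%:Z + 1]/((n + 1)%N%:Z) addn1.
exact: krull_dim_ub (retract_prime_chain RD nP).
Qed.

End Retract.

Theorem proposition3p4 (D : idomainType) (hD : ~ GRing.field_axiom D)
    (R : idomainAlgType D) (hR : retract_algebra R) :
  (* (a) *) injective (GRing.in_alg R) /\
  (* (b) *) (forall S : subalgClosed R, retract_algebra (subalg S)) /\
  (* (c) *) range (@FracField.tofrac R) `&` range (frac_map (GRing.in_alg R))
              = range (fun d : D => FracField.tofrac (GRing.in_alg R d)) /\
  (* (d) *) set_surj (Spec R) (Spec D) (@contraction D R) /\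
  (* (e) *) (range (GRing.in_alg R) <> [set: R] ->
               (krull_dim D + 1 <= krull_dim R)%E).
Proof.
have [_ [f]] := hR.
split; first exact: in_alg_inj_of_retract f.
split; first by move=> S; exact: retract_subalg hR.
split; first exact: retract_frac f.
split; last exact: retract_krull_dim f.
by move=> P PS; exists (f @^-1` P);
  [exact: Spec_preimage PS | exact: contraction_preimage].
Qed.
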